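(* Let $\mathcal{F}$ be a commutative perfect semi-field of characteristic $1$ (satisfying the standing assumptions in the context) which is complete for an F-norm $\|\cdot\|$. Then the map $$\Theta:(\mathcal{F},\oplus,+)\to (C^0(S_E(\mathcal{F}),\mathbb{R}),\max(\,,),+),\qquad X\mapsto \Theta_X,\quad \Theta_X(\phi)=\phi(X),$$ is an injective continuous homomorphism of semi-fields with dense range, where $\mathcal{F}$ carries the topology of $\|\cdot\|$ and $C^0(S_E(\mathcal{F}),\mathbb{R})$ that of the supremum norm.
   Context: A commutative perfect semi-field of characteristic $1$ is a triple $(\mathcal{F},\oplus,+)$ where: $\oplus$ is a commutative associative law with $X\oplus X=X$ for all $X$; $(\mathcal{F},+)$ is an abelian group with identity $0$ and $X+(Y\oplus Z)=(X+Y)\oplus(X+Z)$ for all $X,Y,Z$; for every integer $n\ge 1$ the map $X\mapsto nX$ is surjective (it is then bijective, and $(\mathcal F,+)$ is naturally a $\mathbb{Q}$-vector space). Partial order: $X\le Y$ iff $X\oplus Y=Y$. Standing assumptions: $\mathcal{F}\neq\{0\}$; there is a fixed $E\in\mathcal{F}$ such that for every $X\in\mathcal{F}$ there is $t\in\mathbb{Q}^+$ (non-negative rationals) with $-tE\le X\le tE$; $r(X)\in\mathbb{R}^+$ denotes the infimum of all such $t$; and $r(X)=0$ if and only if $X=0$. An F-norm on $\mathcal{F}$ is a map $\|\cdot\|:\mathcal{F}\to\mathbb{R}^+$ such that for all $t\in\mathbb{Q}$ and $X,Y,X',Y'\in\mathcal{F}$: $\|tX\|=|t|\,\|X\|$,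 $\|X+Y\|\le\|X\|+\|Y\|$, $r(X)\le\|X\|$, and $\|X\oplus Y-X'\oplus Y'\|\le\max(\|X-X'\|,\|Y-Y'\|)$. Complete means complete for the distance $\|X-Y\|$. A character of $\mathcal{F}$ is a map $\phi:\mathcal{F}\to\mathbb{R}$, not identically zero, with $\phi(X\oplus Y)=\max(\phi(X),\phi(Y))$ and $\phi(X+Y)=\phi(X)+\phi(Y)$ for all $X,Y$. $S_E(\mathcal{F})$ is the set of characters with $\phi(E)=1$, endowed with the weakest topology making all maps $\phi\mapsto\phi(X)$, $X\in\mathcal{F}$, continuous (it is compact). A homomorphism of semi-fields is a map compatible with both laws. *)

(* Defs.v *)
From HB Require Import structures.
From mathcomp Require Import all_boot all_order all_algebra.
From mathcomp Require Import all_classical all_reals all_analysis.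
Set Implicit Arguments.
Unset Strict Implicit.
Unset Printing Implicit Defensive.
Import Order.TTheory GRing.Theory Num.Theory.
Import numFieldTopology.Exports numFieldNormedType.Exports.
Local Open Scope classical_set_scope.
Local Open Scope ring_scope.

Reserved Notation "X ⊕ Y" (at level 50, left associativity).

(** Commutative perfect semi-fields of characteristic 1.  The group law is the
    additive law of the underlying [zmodType]. *)
HB.mixin Record isPerfectSemiField F of GRing.Zmodule F := {
  oplus : F -> F -> F ;
  oplusC : commutative oplus ;
  oplusA : associative oplus ;
  oplusXX : idempotent_op oplus ;
  addr_oplusr : forall X Y Z : F, X + oplus Y Z = oplus (X + Y) (X + Z) ;
  mulrn_surj : forall n : nat, (0 < n)%N ->
    forall X : F, exists Y : F, Y *+ n = X
}.

#[short(type="perfectSemiFieldType")]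
HB.structure Definition PerfectSemiField :=
  { F of GRing.Zmodule F & isPerfectSemiField F }.

Notation "X ⊕ Y" := (oplus X Y) : ring_scope.

Definition semifield_hom (F G : perfectSemiFieldType) (f : F -> G) : Prop :=
  (forall X Y, f (X ⊕ Y) = f X ⊕ f Y) /\ (forall X Y, f (X + Y) = f X + f Y).

Section Order_and_scaling.
Variable F : perfectSemiFieldType.
Implicit Types X Y : F.

Definition ople X Y : Prop := X ⊕ Y = Y.

Lemma mulrn_eq0_inj (n : nat) X : (0 < n)%N -> X *+ n = 0 -> X = 0.
Proof.
case: n => // n _ Xn0.
pose Z := fix Z k : F := if k is j.+1 then Z j ⊕ X *+ k else 0.
have ZS k : Z k.+1 = Z k ⊕ X *+ k.+1 by [].
have Zk k : Z k ⊕ X *+ k = Z k.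
  by case: k => [|k]; [rewrite mulr0n /= oplusXX|rewrite ZS -oplusA oplusXX].
have XZ k : 0 ⊕ (X + Z k) = Z k.+1.
  elim: k => [|k IH]; first by rewrite ZS /= addr0 mulr1n.
  by rewrite [in LHS]ZS addr_oplusr -mulrS oplusA IH.
have Z0 k : Z k ⊕ 0 = Z k.
  elim: k => [|k IH]; first by rewrite /= oplusXX.
  by rewrite ZS -oplusA [_ ⊕ 0]oplusC oplusA IH.
have : X + Z n = Z n.
  rewrite -[in LHS](Zk n) addr_oplusr -mulrS Xn0 oplusC XZ ZS Xn0.
  exact: Z0.
by move=> /(congr1 (fun U => U - Z n)); rewrite addrK subrr.
Qed.

Lemma mulrn_inj (n : nat) X Y : (0 < n)%N -> X *+ n = Y *+ n -> X = Y.
Proof.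
move=> n0 XY; apply/eqP; rewrite -subr_eq0; apply/eqP.
by apply: (mulrn_eq0_inj n0); rewrite mulrnBl XY subrr.
Qed.

(** [t X] for rational [t = a / b] is the solution [Y] of [b Y = a X]; it exists
    and is unique by [qscaleP] and [qscale_uniq]. *)
Definition qscale (t : rat) X : F :=
  xget 0 [set Y : F | Y *+ `|denq t|%N = X *~ numq t].

Lemma qscaleP t X : qscale t X *+ `|denq t|%N = X *~ numq t.
Proof.
have d0 : (0 < `|denq t|)%N by rewrite absz_gt0 denq_neq0.
have [Y YX] := mulrn_surj _ d0 (X *~ numq t).
by rewrite /qscale; case: xgetP => [Z _ //|/(_ Y)].
Qed.

Lemma qscale_uniq t X Y : Y *+ `|denq t|%N = X *~ numq t -> Y = qscale t X.
Proof.
move=> YX; apply: (@mulrn_inj `|denq t|%N); first by rewrite absz_gt0 denq_neq0.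
by rewrite YX qscaleP.
Qed.

End Order_and_scaling.

Section Standing_assumptions.
Variables (R : realType) (F : perfectSemiFieldType) (E : F).

Definition sr_bound (X : F) : set rat :=
  [set t | 0 <= t /\ ople (- qscale t E) X /\ ople X (qscale t E)].

Definition sradius (X : F) : R := inf [set (ratr t : R) | t in sr_bound X].

Record standing : Prop := Standing {
  standing_neq0 : exists X : F, X <> 0 ;
  standing_bound : forall X : F, exists t : rat, sr_bound X t ;
  standing_sradius : forall X : F, sradius X = 0 <-> X = 0
}.

Record is_fnorm (N : F -> R) : Prop := IsFnorm {
  fnorm_ge0 : forall X, 0 <= N X ;
  fnormZ : forall (t : rat) X, N (qscale t X) = `|ratr t| * N X ;
  fnormD : forall X Y, N (X + Y) <= N X + N Y ;
  fnorm_sradius : forall X, sradius X <= N X ;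
  fnorm_oplus : forall X Y X' Y',
    N (X ⊕ Y - X' ⊕ Y') <= Num.max (N (X - X')) (N (Y - Y'))
}.

End Standing_assumptions.

Section Metric_space_of_Fnorm.
Variables (R : realType) (F : perfectSemiFieldType) (E : F).
Hypothesis hE : standing R E.
Variable N : F -> R.
Hypothesis hN : is_fnorm E N.

Lemma fnorm0 : N 0 = 0.
Proof.
have <- : qscale 0 0 = 0 :> F.
  by apply/esym/qscale_uniq; rewrite mul0rn mul0rz.
by rewrite (fnormZ hN) rmorph0 normr0 mul0r.
Qed.

Lemma fnormN X : N (- X) = N X.
Proof.
have -> : - X = qscale (-1) X.
  by apply/qscale_uniq; rewrite (_ : `|denq (-1)|%N = 1%N) // mulr1n mulrN1z.
by rewrite (fnormZ hN) rmorphN rmorph1 normrN normr1 mul1r.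
Qed.

Lemma fnorm_eq0 X : N X = 0 -> X = 0.
Proof.
move=> NX0; apply/(standing_sradius hE X)/eqP.
rewrite eq_le -{1}NX0 (fnorm_sradius hN) /=.
apply: lb_le_inf; last by move=> _ [t [t0 _] <-]; rewrite ler0q.
by have [t Xt] := standing_bound hE X; exists (ratr t), t.
Qed.

(** The carrier [F] with the metric [N (X - Y)]. *)
Definition fnorm_space (_ : standing R E) (_ : is_fnorm E N) : Type := F.

Let D := fnorm_space hE hN.
Let dist (X Y : D) : R := N ((X : F) - (Y : F)).

Let distxx X : dist X X = 0.
Proof. by rewrite /dist subrr fnorm0. Qed.

Let dist_eq0 X Y : dist X Y = 0 -> X = Y.
Proof. by move=> /fnorm_eq0 /subr0_eq. Qed.

Let dist_sym X Y : dist X Y = dist Y X.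
Proof. by rewrite /dist -fnormN opprB. Qed.

Let dist_triangle Y X Z : dist X Z <= dist X Y + dist Y Z.
Proof. by rewrite /dist -[X in N X](subrKA (Y : F)) (fnormD hN). Qed.

HB.instance Definition _ := Choice.copy D F.
HB.instance Definition _ := isMetric.Build R D
  distxx dist_eq0 dist_sym dist_triangle.

End Metric_space_of_Fnorm.

(** [completeType] in the library, as a predicate. *)
Definition complete_space (T : uniformType) : Prop :=
  forall G : set_system T, ProperFilter G -> cauchy G -> exists l : T, G --> l.

Section Characters.
Variables (R : realType) (F : perfectSemiFieldType).

Record is_character (phi : F -> R) : Prop := IsCharacter {
  character_neq0 : exists X, phi X <> 0 ;
  character_oplus : forall X Y, phi (X ⊕ Y) = Num.max (phi X) (phi Y) ;
  characterD : forall X Y, phi (X + Y) = phi X + phi Y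
}.

Definition SE (E : F) : Type :=
  set_type [set phi : F -> R | is_character phi /\ phi E = 1].

Variable E : F.

HB.instance Definition _ := Choice.on (SE E).

Definition char_eval (X : F) (phi : SE E) : R := (\val phi : F -> R) X.

(** Coarsest topology making every evaluation continuous. *)
HB.instance Definition _ := Topological.copy (SE E)
  (sup_topology (fun X : F => Topological.on (initial_topology (char_eval X)))).

Lemma char_eval_continuous X : continuous (char_eval X).
Proof.
move=> phi; have /cvg_sup/(_ X) : nbhs phi --> (phi : SE E) by apply: cvg_id.
move=> h; apply: cvg_trans (@initial_continuous _ _ (char_eval X) phi).
exact: cvg_app h.
Qed.

End Characters.

Section Continuous_functions.
Variables (R : realType) (T : topologicalType).

Definition C0 : Type := continuousType T R.

HB.instance Definition _ := Choice.on C0.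

(** Uniform convergence; by [C0_nbhsP] this is the topology of the supremum
    norm. *)
HB.instance Definition _ := PseudoMetric.copy C0
  (initial_topology (fun f : C0 => (f : T -> R) : arrow_uniform_type T R)).

Definition sup_dist (f g : C0) : \bar R :=
  ereal_sup [set `|f x - g x|%:E | x in [set: T]].

Lemma C0_ballE (f g : C0) (e : R) :
  ball f e g <-> forall t : T, `|f t - g t| < e.
Proof.
have -> : ball f e g = forall t : T, ball (f t : R) e (g t : R) by [].
by split=> fg t; have := fg t; rewrite -ball_normE.
Qed.

Lemma C0_nbhsP (f : C0) (A : set C0) :
  nbhs f A <-> exists2 e : R, 0 < e & [set g | (sup_dist f g < e%:E)%E] `<=` A.
Proof.
split=> [/nbhs_ballP [e e0 sub]|[e e0 sub]].
  exists e => // g /= fg; apply: sub; apply/C0_ballE => t; rewrite -lte_fin.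
  by apply: le_lt_trans fg; apply: ereal_sup_ubound; exists t.
apply/nbhs_ballP; exists (e / 2); first by rewrite /= divr_gt0.
move=> g /C0_ballE fg; apply: sub => /=; apply: (@le_lt_trans _ _ (e / 2)%:E).
  by apply: ge_ereal_sup => _ [t _ <-]; rewrite lee_fin ltW.
by rewrite lte_fin ltr_pdivrMr // ltr_pMr // ltr1n.
Qed.

Definition C0_mk (f : T -> R) (cf : continuous f) : C0 := mkcts cf.

Let cts (f : C0) : continuous (f : T -> R).
Proof. exact: cts_fun. Qed.

Definition C0_zero : C0 := C0_mk (fun x => @cst_continuous T R 0 x).
Definition C0_opp (f : C0) : C0 :=
  C0_mk (fun x => continuousN (@cts f x)).
Definition C0_add (f g : C0) : C0 :=
  C0_mk (fun x => continuousD (@cts f x) (@cts g x)).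
Definition C0_max (f g : C0) : C0 :=
  C0_mk (fun x => continuous_max (@cts f x) (@cts g x)).

Let C0P (f g : C0) : f =1 g -> f = g.
Proof. by move/continuousEP. Qed.

Let C0_addA : associative C0_add.
Proof. by move=> f g h; apply: C0P => x; exact: addrA. Qed.

Let C0_addC : commutative C0_add.
Proof. by move=> f g; apply: C0P => x; exact: addrC. Qed.

Let C0_add0 : left_id C0_zero C0_add.
Proof. by move=> f; apply: C0P => x; exact: add0r. Qed.

Let C0_addN : left_inverse C0_zero C0_opp C0_add.
Proof. by move=> f; apply: C0P => x; exact: addNr. Qed.

HB.instance Definition _ := GRing.isZmodule.Build C0
  C0_addA C0_addC C0_add0 C0_addN.

Let C0_mulrnE (f : C0) n x : (f *+ n) x = f x *+ n.
Proof. by elim: n => [//|n IH]; rewrite !mulrS -IH. Qed.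

Let C0_maxC : commutative C0_max.
Proof. by move=> f g; apply: C0P => x; exact: maxC. Qed.

Let C0_maxA : associative C0_max.
Proof. by move=> f g h; apply: C0P => x; exact: maxA. Qed.

Let C0_maxXX : idempotent_op C0_max.
Proof. by move=> f; apply: C0P => x; exact: maxxx. Qed.

Let C0_add_max (f g h : C0) : f + C0_max g h = C0_max (f + g) (f + h).
Proof. by apply: C0P => x; exact: addr_maxr. Qed.

Let C0_mulrn_surj (n : nat) : (0 < n)%N -> forall f : C0, exists g, g *+ n = f.
Proof.
move=> n0 f; exists (C0_mk (fun x =>
  continuousM (@cts f x) (@cst_continuous T R n%:R^-1 x))).
apply: C0P => x; rewrite C0_mulrnE; change ((f x * n%:R^-1) *+ n = f x).
by rewrite -mulr_natr divfK // pnatr_eq0 -lt0n.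
Qed.

HB.instance Definition _ := isPerfectSemiField.Build C0
  C0_maxC C0_maxA C0_maxXX C0_add_max C0_mulrn_surj.

Lemma C0_oplusE (f g : C0) x : (f ⊕ g) x = Num.max (f x) (g x).
Proof. by []. Qed.

Lemma C0_addE (f g : C0) x : (f + g) x = f x + g x.
Proof. by []. Qed.

End Continuous_functions.

Definition Theta (R : realType) (F : perfectSemiFieldType) (E : F) (X : F) :
    C0 R (SE R E) :=
  C0_mk (@char_eval_continuous R F E X).

Lemma ThetaE (R : realType) (F : perfectSemiFieldType) (E X : F)
    (phi : SE R E) :
  Theta R E X phi = (\val phi : F -> R) X.
Proof. by []. Qed.

(* Main.v *)
(** A functional [q : F -> R] is called max-linear here when it is subadditive,
    satisfies [n q(X) <= q(nX)] and sends [⊕] below [max].  The gauge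
    [p(X) = inf {t in Q | X <= t E}] is max-linear, and so is, for any
    max-linear [q] and any [Z], the infimum of the nonincreasing sequence
    [q(X + nZ) - n q(Z)], whose value at [-Z] is at most [- q(Z)].  A minimal
    max-linear functional is therefore odd, hence additive; one lying below the
    shift of [p] by [X] is a character of value [p(X)] at [X].  Since [p(X)]
    and [p(-X)] control [r(X)], characters separate points.

    Compactness of [S_E(F)] comes from pointwise limits along ultrafilters.
    Rational combinations of [X] and [E] interpolate any two values at any two
    characters up to [e], and a two-step compactness argument (meets, then
    joins), as in the lattice form of Stone-Weierstrass, gives density. *)

Require Import Defs.
From HB Require Import structures.
From mathcomp Require Import all_boot all_order all_algebra.
From mathcomp Require Import all_classical all_reals all_analysis.
From mathcomp Require Import ring lra.
Import Order.TTheory GRing.Theory Num.Theory.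
Import numFieldTopology.Exports numFieldNormedType.Exports.
Local Open Scope classical_set_scope.
Local Open Scope ring_scope.

Set Implicit Arguments.
Unset Strict Implicit.
Unset Printing Implicit Defensive.

(** * Order and rational scaling *)

Section Order.
Variable F : perfectSemiFieldType.
Implicit Types X Y Z : F.

Lemma ople_refl X : ople X X.
Proof. exact: oplusXX. Qed.

Lemma ople_trans X Y Z : ople X Y -> ople Y Z -> ople X Z.
Proof. by rewrite /ople => XY YZ; rewrite -YZ oplusA XY. Qed.

Lemma ople_antisym X Y : ople X Y -> ople Y X -> X = Y.
Proof. by move=> XY YX; rewrite -XY oplusC; exact: esym. Qed.

Lemma ople_add2l Z X Y : ople X Y -> ople (Z + X) (Z + Y).
Proof. by rewrite /ople -addr_oplusr => ->. Qed.

Lemma ople_add X Y X' Y' : ople X Y -> ople X' Y' -> ople (X + X') (Y + Y').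
Proof.
move=> /(ople_add2l X'); rewrite ![X' + _]addrC => XY /(ople_add2l Y).
exact: ople_trans XY.
Qed.

Lemma ople_opp X Y : ople X Y -> ople (- Y) (- X).
Proof.
move=> /(ople_add2l (- X - Y)); rewrite subrK.
by have -> : - X - Y + X = - Y by rewrite addrAC addNr add0r.
Qed.

Lemma ople_sub X Y : ople X Y <-> ople (X - Y) 0.
Proof.
split=> [/(ople_add2l (- Y))|/(ople_add2l Y)].
  by rewrite addNr addrC.
by rewrite addr0 addrC subrK.
Qed.

Lemma ople_oplusl X Y : ople X (X ⊕ Y).
Proof. by rewrite /ople oplusA oplusXX. Qed.

Lemma ople_oplusr X Y : ople Y (X ⊕ Y).
Proof. by rewrite oplusC; exact: ople_oplusl. Qed.

Lemma ople_oplus X Y Z : ople X Z -> ople Y Z -> ople (X ⊕ Y) Z.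
Proof. by rewrite /ople -oplusA => XZ ->. Qed.

(* With [Z k = 0 ⊕ X ⊕ ... ⊕ kX], one has [Z k.+1 = 0 ⊕ (X + Z k)], and
   [nX <= 0] makes [Z] stationary at [n - 1], so [X + Z (n - 1) <= Z (n - 1)]. *)
Lemma mulrn_le0 (n : nat) X : (0 < n)%N -> ople (X *+ n) 0 -> ople X 0.
Proof.
case: n => // n _ Xn0.
pose Z := fix Z k : F := if k is j.+1 then Z j ⊕ X *+ k else 0.
have ZS k : Z k.+1 = Z k ⊕ X *+ k.+1 by [].
have Z_ge0 k : ople 0 (Z k).
  elim: k => [|k IH]; first exact: ople_refl.
  by apply: ople_trans IH _; rewrite ZS; exact: ople_oplusl.
have XZ k : 0 ⊕ (X + Z k) = Z k.+1.
  elim: k => [|k IH]; first by rewrite ZS /= addr0 mulr1n.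
  by rewrite [in LHS]ZS addr_oplusr -mulrS oplusA IH.
have ZnS : Z n.+1 = Z n.
  by rewrite ZS oplusC; exact: ople_trans Xn0 (Z_ge0 n).
have := ople_oplusr 0 (X + Z n); rewrite XZ ZnS => /ople_sub.
by rewrite addrK.
Qed.

Lemma ople_mulrn (n : nat) X Y :
  (0 < n)%N -> ople (X *+ n) (Y *+ n) -> ople X Y.
Proof.
by move=> n0 /ople_sub; rewrite -mulrnBl => /(mulrn_le0 n0) XY; exact/ople_sub.
Qed.

Lemma mulrn_ge0 (n : nat) X : ople 0 X -> ople 0 (X *+ n).
Proof.
move=> X0; elim: n => [|n IH]; first exact: ople_refl.
by have := ople_add X0 IH; rewrite addr0 -mulrS.
Qed.

(** [qscale] is defined through the reduced fraction. Cross-multiplying and cancelling [b] by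
    [mulrn_inj] shows that any fraction representing [t] will do, such as the unreduced one arising
    for a sum. *)
Lemma qscale_frac (t : rat) (a : int) (b : nat) X Y : (0 < b)%N ->
  t * b%:R = a%:~R -> Y *+ b = X *~ a -> Y = qscale t X.
Proof.
move=> b0 tba YX; apply: qscale_uniq; apply: (mulrn_inj b0).
have tb : (numq t * b = a * `|denq t|%N)%R.
  apply/eqP; rewrite -(eqr_int rat) !rmorphM /= absz_denq numqE -tba.
  by rewrite mulrAC.
by rewrite mulrnAC YX !pmulrn -!mulrzA tb.
Qed.

Lemma qscale_nat (n : nat) X : qscale n%:R X = X *+ n.
Proof. by apply/esym/(@qscale_frac _ n 1) => //; rewrite mulr1. Qed.

Lemma qscale0 X : qscale 0 X = 0.
Proof. by rewrite (qscale_nat 0). Qed.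

Lemma qscale1 X : qscale 1 X = X.
Proof. by rewrite (qscale_nat 1). Qed.

Lemma qscaleD (s t : rat) X : qscale (s + t) X = qscale s X + qscale t X.
Proof.
have gt0 (r : rat) : (0 < `|denq r|)%N by rewrite absz_gt0 denq_neq0.
have numqn (r : rat) : r * `|denq r|%:R = (numq r)%:~R.
  by rewrite numqE -[in RHS]absz_denq.
apply/esym/(@qscale_frac _ (numq s * `|denq t|%N + numq t * `|denq s|%N)
  (`|denq s| * `|denq t|)).
- by rewrite muln_gt0 !gt0.
- by rewrite natrM rmorphD !rmorphM /= -!numqn; ring.
- rewrite mulrnDl [in X in _ + X]mulnC !mulrnA !qscaleP.
  by rewrite mulrzDr !mulrzA -!pmulrn.
Qed.

Lemma qscaleN (t : rat) X : qscale (- t) X = - qscale t X.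
Proof. by apply/eqP; rewrite -addr_eq0 -qscaleD addNr qscale0. Qed.

Lemma qscale_mulrn (t : rat) n X : qscale (t *+ n) X = qscale t X *+ n.
Proof.
elim: n => [|n IH]; first exact: qscale0.
by rewrite !mulrS qscaleD IH.
Qed.

Lemma qscale_ge0 (t : rat) X : 0 <= t -> ople 0 X -> ople 0 (qscale t X).
Proof.
move=> t0 X0; apply: (@ople_mulrn `|denq t|); first by rewrite absz_gt0 denq_neq0.
rewrite mul0rn qscaleP; move: t0; rewrite -numq_ge0.
by case: (numq t) => // n _; exact: mulrn_ge0.
Qed.

Lemma ople_qscale (s t : rat) X :
  s <= t -> ople 0 X -> ople (qscale s X) (qscale t X).
Proof.
rewrite -subr_ge0 => st /(qscale_ge0 st)/(ople_add2l (qscale s X)).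
by rewrite addr0 -qscaleD addrC subrK.
Qed.

End Order.

(** * Max-linear functionals *)

Section Maxlinear.
Variables (R : realType) (F : perfectSemiFieldType).
Implicit Types (X Y Z : F) (q : F -> R).

(** Only inequalities are required, because these pass to infima; the reverse of
    [maxlinear_le_mulrn] follows from subadditivity, as in [maxlinear_mulrn]. *)
Record maxlinear q : Prop := Maxlinear {
  maxlinearD : forall X Y, q (X + Y) <= q X + q Y ;
  maxlinear_le_mulrn : forall n X, q X *+ n <= q (X *+ n) ;
  maxlinear_oplus : forall X Y, q (X ⊕ Y) <= Num.max (q X) (q Y)
}.

Lemma maxlinear0 q : maxlinear q -> q 0 = 0.
Proof.
move=> hq; apply/eqP; rewrite eq_le.
(* The case [n = 0] gives [0 <= q 0]; the case [n = 2] gives [2 q 0 <= q 0]. *)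
have := maxlinear_le_mulrn hq 0 0; rewrite mulr0n => ->; rewrite andbT.
have := maxlinear_le_mulrn hq 2 0; rewrite mul0rn mulr2n; lra.
Qed.

Lemma maxlinearN q X : maxlinear q -> - q (- X) <= q X.
Proof.
move=> hq; rewrite -subr_ge0 opprK -(maxlinear0 hq) -(subrr X).
exact: maxlinearD.
Qed.

Lemma maxlinear_mulrn q n X : maxlinear q -> q (X *+ n) = q X *+ n.
Proof.
move=> hq; apply/eqP; rewrite eq_le maxlinear_le_mulrn // andbT.
elim: n => [|n IH]; first by rewrite !mulr0n maxlinear0.
by rewrite !mulrS; apply: le_trans (maxlinearD hq _ _) _; rewrite lerD2l.
Qed.

(** The members of [A] need not be max-linear: each inequality may pass from given members to
    another one. This covers both monotone sequences and chains of functionals. *)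
Lemma inf_maxlinear (A : set (F -> R)) :
  A !=set0 -> (forall X, has_lbound [set q X | q in A]) ->
  (forall q1 q2 X Y, A q1 -> A q2 ->
    exists2 q, A q & q (X + Y) <= q1 X + q2 Y) ->
  (forall q n X, A q -> exists2 q', A q' & q' X *+ n <= q (X *+ n)) ->
  (forall q1 q2 X Y, A q1 -> A q2 ->
    exists2 q, A q & q (X ⊕ Y) <= Num.max (q1 X) (q2 Y)) ->
  maxlinear (fun X => inf [set q X | q in A]).
Proof.
move=> [q0 Aq0] lbA AD AM AO.
have ne X : [set q X | q in A] !=set0 by exists (q0 X), q0.
have lb X q : A q -> inf [set q X | q in A] <= q X.
  by move=> Aq; apply: ge_inf; [exact: lbA|exists q].
have ub X c : inf [set q X | q in A] < c -> exists2 q, A q & q X < c.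
  by move=> /(inf_lt (ne X)) [_ [q Aq <-] qc]; exists q.
split=> [X Y|n X|X Y].
- apply/unstable.ler_gtP => z XYz.
  set x := inf _ in XYz *; set y := inf _ in XYz *.
  have /ub [q1 Aq1 q1X] : x < x + (z - (x + y)) / 2 by lra.
  have /ub [q2 Aq2 q2Y] : y < y + (z - (x + y)) / 2 by lra.
  have [q Aq qXY] := AD q1 q2 X Y Aq1 Aq2.
  apply: le_trans (lb _ _ Aq) _; lra.
- apply: lb_le_inf; first exact: ne.
  move=> _ [q Aq <-]; have [q' Aq' q'X] := AM q n X Aq.
  by apply: le_trans q'X; rewrite lerMn2r lb ?orbT.
- apply/unstable.ler_gtP => z; rewrite gt_max => /andP [Xz Yz].
  have [q1 Aq1 q1X] := ub _ _ Xz; have [q2 Aq2 q2Y] := ub _ _ Yz.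
  have [q Aq qXY] := AO q1 q2 X Y Aq1 Aq2.
  apply: le_trans (lb _ _ Aq) _; apply: le_trans qXY _.
  by rewrite ge_max !ltW.
Qed.

(** Subadditivity and homogeneity along [Z] make [s] nonincreasing in [n], and [- q (- X)] bounds it
    below. The index [0] gives [q' <= q]; the index [1] gives the bound at [- Z]. *)
Lemma maxlinear_shift q Z : maxlinear q ->
  exists q', [/\ maxlinear q', forall X, q' X <= q X & q' (- Z) <= - q Z].
Proof.
move=> hq; pose s n X := q (X + Z *+ n) - q Z *+ n.
have s_anti n m X : (n <= m)%N -> s m X <= s n X.
  move=> nm; have := maxlinearD hq (X + Z *+ n) (Z *+ (m - n)).
  rewrite -addrA -mulrnDr subnKC // (maxlinear_mulrn (m - n)%N) // mulrnBr //.
  by rewrite /s lerBlDr addrAC -addrA.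
pose A := [set s n | n in [set: nat]].
have lbA X : has_lbound [set q X | q in A].
  exists (- q (- X)) => _ [_ [n _ <-] <-]; rewrite /s lerBrDr addrC.
  rewrite lerBlDr -maxlinear_mulrn //; apply: le_trans (maxlinearD hq _ _).
  by rewrite addrAC subrr add0r.
have lb n X : inf [set q X | q in A] <= s n X.
  by apply: ge_inf; [exact: lbA|exists (s n) => //; exists n].
exists (fun X => inf [set q X | q in A]); split.
- apply: inf_maxlinear => //; first by exists (s 0), 0.
  + move=> _ _ X Y [n _ <-] [m _ <-].
    exists (s (n + m)%N); first by exists (n + m)%N.
    rewrite /s !mulrnDr addrACA opprD [leRHS]addrACA lerD2r.
    exact: maxlinearD.
  + move=> _ n X [m _ <-]; exists (s m); first by exists m.
    case: n => [|n].
      by rewrite !mulr0n /s add0r maxlinear_mulrn // subrr.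
    (* Multiplying [s m X] by [n.+1] gives exactly [s (m * n.+1) (X *+ n.+1)], and
       [m <= m * n.+1]. *)
    apply: le_trans (@s_anti _ (m * n.+1)%N _ _); last by rewrite leq_pmulr.
    by rewrite /s mulrnBl !mulrnA -mulrnDl maxlinear_mulrn.
  + move=> _ _ X Y [n _ <-] [m _ <-].
    (* At a common index both arguments are translated by the same element, over which [⊕] and [max]
       distribute. *)
    exists (s (maxn n m)); first by exists (maxn n m).
    have sn := s_anti _ _ X (leq_maxl n m).
    have sm := s_anti _ _ Y (leq_maxr n m).
    apply: le_trans (le_max2 sn sm); rewrite /s.
    rewrite [_ ⊕ _ + _]addrC addr_oplusr ![Z *+ _ + _]addrC -addr_maxl.
    rewrite lerD2r; exact: maxlinear_oplus.
- by move=> X; have := lb 0%N X; rewrite /s !mulr0n addr0 subr0.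
- have := lb 1%N (- Z); rewrite /s !mulr1n addNr.
  by rewrite maxlinear0 // sub0r.
Qed.

(* Zorn: by [maxlinear_shift], a minimal max-linear functional is odd. *)
Lemma maxlinear_minorant p : maxlinear p ->
  exists q, [/\ maxlinear q, forall X, q X <= p X & forall X, q (- X) = - q X].
Proof.
move=> hp; pose P q := maxlinear q /\ forall X, q X <= p X; pose T := {q | P q}.
(* The order is reversed, so that a maximal element for Zorn is a minimal functional. *)
pose le (q1 q2 : T) := `[< forall X, sval q2 X <= sval q1 X >].
have [||A tot|q qmin] := @ZL_preorder T (exist P p (conj hp (fun=> lexx _))) le.
- by move=> q; apply/asboolP => X.
- move=> q1 q2 q3 /asboolP q12 /asboolP q23; apply/asboolP => X.
  exact: le_trans (q23 X) (q12 X).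
(* The empty chain is bounded by [p] itself; a nonempty one by its pointwise infimum. *)
- have [->|/set0P [q0 Aq0]] := eqVneq A set0.
    by exists (exist P p (conj hp (fun=> lexx _))).
  pose B := [set sval q | q in A].
  have lbB X : has_lbound [set q X | q in B].
    exists (- p (- X)) => _ [_ [[q [hq qp] ?] <-] <-] /=.
    by apply: le_trans (maxlinearN X hq); rewrite lerN2.
  have lb (q : T) X : A q -> inf [set q X | q in B] <= sval q X.
    by move=> Aq; apply: ge_inf; [exact: lbB|exists (sval q) => //; exists q].
  have min (q1 q2 : T) : A q1 -> A q2 -> exists2 q, A q &
      (forall X, sval q X <= sval q1 X) /\ (forall X, sval q X <= sval q2 X).
    move=> Aq1 Aq2; have [/asboolP q12|/asboolP q21] := tot _ _ Aq1 Aq2.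
      by exists q2.
    by exists q1.
  have hB : maxlinear (fun X => inf [set q X | q in B]).
    apply: inf_maxlinear => //; first by exists (sval q0), q0.
    + move=> _ _ X Y [q1 Aq1 <-] [q2 Aq2 <-].
      have [q Aq [qq1 qq2]] := min _ _ Aq1 Aq2.
      exists (sval q); first by exists q.
      apply: le_trans (maxlinearD (svalP q).1 _ _) _; exact: lerD.
    + move=> _ n X [q Aq <-]; exists (sval q); first by exists q.
      exact: (maxlinear_le_mulrn (svalP q).1).
    + move=> _ _ X Y [q1 Aq1 <-] [q2 Aq2 <-].
      have [q Aq [qq1 qq2]] := min _ _ Aq1 Aq2.
      exists (sval q); first by exists q.
      apply: le_trans (maxlinear_oplus (svalP q).1 _ _) _; exact: le_max2.
  have Bp X : inf [set q X | q in B] <= p X.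
    exact: le_trans (lb _ _ Aq0) ((svalP q0).2 X).
  exists (exist P _ (conj hB Bp)) => q Aq; apply/asboolP => X /=.
  exact: lb.
- have [hq qp] := svalP q; exists (sval q); split=> // Z.
  have [q' [hq' q'q q'Z]] := maxlinear_shift Z hq.
  have q'p X : q' X <= p X by apply: le_trans (q'q X) (qp X).
  (* Minimality gives [q <= q'], hence [q (- Z) <= q' (- Z) <= - q Z]. *)
  have /qmin/asboolP/= qq' : le q (exist P q' (conj hq' q'p)) by apply/asboolP.
  apply/eqP; rewrite eq_le (le_trans (qq' _) q'Z) /=.
  by rewrite -lerN2 opprK; exact: maxlinearN.
Qed.

(** Superadditivity comes from [q X = q ((X + Y) - Y) <= q (X + Y) - q Y]. *)
Lemma maxlinear_odd_additive q : maxlinear q -> (forall X, q (- X) = - q X) ->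
  {morph q : X Y / X + Y}.
Proof.
move=> hq qN X Y; apply/eqP; rewrite eq_le maxlinearD //=.
by have := maxlinearD hq (X + Y) (- Y); rewrite addrK qN lerBrDr.
Qed.

End Maxlinear.

(** * Characters attaining the gauge *)

Section Additive.
Variables (R : realType) (F : perfectSemiFieldType) (f : F -> R).
Hypothesis fD : {morph f : X Y / X + Y}.

Lemma additive0 : f 0 = 0.
Proof. by have := fD 0 0; rewrite addr0; lra. Qed.

Lemma additiveN X : f (- X) = - f X.
Proof. by have := fD X (- X); rewrite subrr additive0; lra. Qed.

Lemma additive_mulrn n X : f (X *+ n) = f X *+ n.
Proof.
by elim: n => [|n IH]; rewrite ?mulr0n ?additive0 // !mulrS fD IH.
Qed.

Lemma additive_mulrz (n : int) X : f (X *~ n) = f X *~ n.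
Proof.
case: n => n; first by rewrite -!pmulrn additive_mulrn.
by rewrite NegzE !mulrNz -!pmulrn additiveN additive_mulrn.
Qed.

Lemma additive_qscale t X : f (qscale t X) = ratr t * f X.
Proof.
have d0 : (`|denq t|%:R : R) != 0 by rewrite pnatr_eq0 absz_eq0 denq_neq0.
apply: (mulIf d0); rewrite mulr_natr -additive_mulrn qscaleP additive_mulrz.
rewrite mulrAC -mulrzl; congr (_ * _).
by rewrite /ratr -[in X in _ / X]absz_denq -pmulrn divfK.
Qed.

End Additive.

(** * The gauge of the unit [E] *)

Section Gauge.
Variables (R : realType) (F : perfectSemiFieldType) (E : F).
Hypothesis hE : standing R E.
Implicit Types X Y Z : F.

(** Bounding a nonzero [X] by [- t E <= X <= t E] forces [t > 0] and [0 <= 2 t E]; clearing the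
    denominator and cancelling the resulting positive integer leaves [0 <= E]. *)
Lemma unit_ge0 : ople 0 E.
Proof.
have [X X0] := standing_neq0 hE; have [t [t0 [tX Xt]]] := standing_bound hE X.
have tn0 : t != 0.
  apply/eqP => t00; apply: X0; move: tX Xt; rewrite t00 qscale0 oppr0.
  by move=> tX Xt; exact: ople_antisym.
have /(ople_add2l (qscale t E)) := ople_trans tX Xt.
rewrite subrr => /(mulrn_ge0 `|denq t|); rewrite mulrnDl qscaleP.
have : 0 < numq t by rewrite numq_gt0 lt_def tn0.
case: (numq t) => // n n0; rewrite -pmulrn -mulrnDr => En.
by apply: (@ople_mulrn _ (n + n)); rewrite ?mul0rn // addn_gt0 -ltz_nat n0.
Qed.

Lemma unit_neq0 : E <> 0.
Proof.
move=> E0; have [X X0] := standing_neq0 hE; apply: X0.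
have [t [_ [tX Xt]]] := standing_bound hE X; move: tX Xt.
rewrite (_ : qscale t E = 0) ?oppr0; first by move=> ? ?; exact: ople_antisym.
by apply/esym/qscale_uniq; rewrite mul0rn E0 mul0rz.
Qed.

(** A negative [t] would give [t E = 0] by antisymmetry, hence [E = 0] since there is no torsion. *)
Lemma qscale_unit_ge0 t : ople 0 (qscale t E) -> 0 <= t.
Proof.
move=> tE; rewrite leNgt; apply/negP => t0; apply: unit_neq0.
have Et : ople (qscale t E) 0.
  by rewrite -(qscale0 E); apply: ople_qscale unit_ge0; exact: ltW.
have := qscaleP t E; rewrite -(ople_antisym tE Et) mul0rn => /esym.
have : numq t < 0 by rewrite numq_lt0.
case: (numq t) => // n _; rewrite NegzE mulrNz -pmulrn => /eqP.
by rewrite oppr_eq0 => /eqP; exact: mulrn_eq0_inj.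
Qed.

(** One-sided form of [sradius], in which [t] may be negative. *)
Definition gauge X : R := inf [set ratr t | t in [set t | ople X (qscale t E)]].

Lemma gauge_set_neq0 X :
  [set (ratr t : R) | t in [set t | ople X (qscale t E)]] !=set0.
Proof.
by have [t [_ [_ Xt]]] := standing_bound hE X; exists (ratr t), t.
Qed.

Lemma gauge_le X t : ople X (qscale t E) -> gauge X <= ratr t.
Proof.
move=> Xt; apply: ge_inf; last by exists t.
(* The set is bounded below: [- u E <= X <= s E] forces [- u <= s]. *)
have [u [_ [uX _]]] := standing_bound hE X.
exists (ratr (- u)) => _ [s Xs <-]; rewrite ler_rat.
have := ople_add2l (qscale u E) (ople_trans uX Xs).
by rewrite subrr -qscaleD => /qscale_unit_ge0; lra.
Qed.

Lemma gauge_lt X c : gauge X < c -> exists2 t, ople X (qscale t E) & ratr t < c.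
Proof.
by move=> /(inf_lt (gauge_set_neq0 X)) [_ [t Xt <-] tc]; exists t.
Qed.

Lemma gauge_maxlinear : maxlinear gauge.
Proof.
split=> [X Y|n X|X Y].
- apply/unstable.ler_gtP => z XYz.
  set x := gauge X in XYz *; set y := gauge Y in XYz *.
  have /gauge_lt [s Xs sx] : x < x + (z - (x + y)) / 2 by lra.
  have /gauge_lt [t Yt ty] : y < y + (z - (x + y)) / 2 by lra.
  have /gauge_le : ople (X + Y) (qscale (s + t) E).
    by rewrite qscaleD; exact: ople_add.
  by rewrite rmorphD /=; lra.
- apply: lb_le_inf; first exact: gauge_set_neq0.
  move=> _ [t Xt <-]; case: n Xt => [|n] Xt.
    by rewrite mulr0n ler0q; exact: qscale_unit_ge0.
  have tn : t = t / n.+1%:R *+ n.+1 by rewrite -mulr_natr divfK ?pnatr_eq0.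
  rewrite tn rmorphMn /= lerMn2r gauge_le ?orbT //.
  by apply: (@ople_mulrn _ n.+1) => //; rewrite -qscale_mulrn -tn.
- apply/unstable.ler_gtP => z; rewrite gt_max => /andP [].
  move=> /gauge_lt [s Xs sz] /gauge_lt [t Yt tz].
  (* Since [0 <= E], [u E] is monotone in [u], so [max s t] serves for both [X] and [Y]. *)
  have ub u : u <= Num.max s t -> ople (qscale u E) (qscale (Num.max s t) E).
    by move=> ?; apply: ople_qscale unit_ge0.
  apply: (@le_trans _ _ (ratr (Num.max s t))).
    apply: gauge_le; apply: ople_oplus.
      by apply: ople_trans Xs (ub _ _); rewrite le_max lexx.
    by apply: ople_trans Yt (ub _ _); rewrite le_max lexx orbT.
  by case: (leP s t) => _; exact: ltW.
Qed.

Lemma gauge_eq0 X : gauge X <= 0 -> gauge (- X) <= 0 -> X = 0.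
Proof.
move=> X0 NX0; apply/(standing_sradius hE X)/eqP.
rewrite eq_le; apply/andP; split.
  apply/unstable.ler_gtP => z z0.
  have [s Xs sz] := gauge_lt (le_lt_trans X0 z0).
  have [t Xt tz] := gauge_lt (le_lt_trans NX0 z0).
  (* The [0] is there because [sr_bound] admits only nonnegative rationals. *)
  pose u := Num.max 0 (Num.max s t).
  have uz : ratr u <= z.
    rewrite /u; case: (leP 0 _) => _; last by rewrite rmorph0 ltW.
    by case: (leP s t) => _; exact: ltW.
  apply: le_trans uz; apply: ge_inf.
    by exists 0 => _ [v [v0 _] <-]; rewrite ler0q.
  exists u => //; split; first by rewrite le_max lexx.
  split.
    rewrite -[X]opprK; apply: ople_opp; apply: ople_trans Xt _.
    by apply: ople_qscale unit_ge0; rewrite !le_max lexx !orbT.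
  apply: ople_trans Xs _.
  by apply: ople_qscale unit_ge0; rewrite !le_max lexx !orbT.
apply: lb_le_inf; last by move=> _ [t [t0 _] <-]; rewrite ler0q.
by have [t Xt] := standing_bound hE X; exists (ratr t), t.
Qed.

Lemma char_evalD (phi : SE R E) :
  {morph (fun X => char_eval X phi) : X Y / X + Y}.
Proof. by have /set_mem [[_ _ pD] _] := svalP phi; exact: pD. Qed.

Lemma char_eval_oplus (phi : SE R E) X Y :
  char_eval (X ⊕ Y) phi = Num.max (char_eval X phi) (char_eval Y phi).
Proof. by have /set_mem [[_ pO _] _] := svalP phi; exact: pO. Qed.

Lemma char_eval_unit (phi : SE R E) : char_eval E phi = 1.
Proof. by have /set_mem [_] := svalP phi. Qed.

Lemma char_eval_le (phi : SE R E) X Y :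
  ople X Y -> char_eval X phi <= char_eval Y phi.
Proof. by move=> <-; rewrite char_eval_oplus le_max lexx. Qed.

Lemma char_eval_bound (phi : SE R E) X t :
  sr_bound E X t -> `|char_eval X phi| <= ratr t.
Proof.
move=> [_ [/(char_eval_le phi) tX /(char_eval_le phi) Xt]]; move: tX Xt.
rewrite (additiveN (@char_evalD phi)) (additive_qscale (char_evalD phi)).
by rewrite char_eval_unit mulr1 ler_norml => -> ->.
Qed.

Lemma char_eval_sradius (phi : SE R E) X : `|char_eval X phi| <= sradius R E X.
Proof.
apply: lb_le_inf; last by move=> _ [t Xt <-]; exact: char_eval_bound.
by have [t Xt] := standing_bound hE X; exists (ratr t), t.
Qed.

(** Shifting [gauge] by [X] before taking an odd minorant [f] forces [f (- X) <= - gauge X], that is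
    [gauge X <= f X]. The bound [f <= gauge] gives the converse, monotonicity and the
    normalization. *)
Lemma char_eval_eq_gauge X : exists phi : SE R E, char_eval X phi = gauge X.
Proof.
have [q [hq q_le qX]] := maxlinear_shift X gauge_maxlinear.
have [f [hf f_le fN]] := maxlinear_minorant hq.
have fD := maxlinear_odd_additive hf fN.
have fg Y : f Y <= gauge Y := le_trans (f_le Y) (q_le Y).
have f_mono Y Z : ople Y Z -> f Y <= f Z.
  move=> /ople_sub YZ; rewrite -subr_le0 -fN -fD; apply: le_trans (fg _) _.
  by rewrite -(rmorph0 ratr); apply: gauge_le; rewrite qscale0.
(* The two halves come from [gauge E <= 1] and [gauge (- E) <= -1]. *)
have fE : f E = 1.
  apply/eqP; rewrite eq_le -(rmorph1 ratr) (le_trans (fg E)) /=; last first.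
    by apply: gauge_le; rewrite qscale1; exact: ople_refl.
  rewrite -lerN2 -fN -rmorphN /= (le_trans (fg _)) // gauge_le //.
  by rewrite qscaleN qscale1; exact: ople_refl.
have fchar : is_character f.
  split=> //; first by exists E; rewrite fE; exact/eqP/oner_neq0.
  move=> Y Z; apply/eqP; rewrite eq_le maxlinear_oplus //= ge_max.
  by rewrite !f_mono //; [exact: ople_oplusr|exact: ople_oplusl].
exists (exist _ f (mem_set (conj fchar fE))); apply/eqP.
rewrite eq_le [_ <= _]fg /= -lerN2 [leLHS](_ : _ = f (- X)) ?fN //.
by apply: le_trans qX; rewrite -fN; exact: f_le.
Qed.

Lemma Theta_injective : injective (Theta R E).
Proof.
move=> X Y XY; apply: subr0_eq.
have XY0 (phi : SE R E) : char_eval (X - Y) phi = 0.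
  have := congr1 (fun f : C0 R (SE R E) => f phi) XY; rewrite !ThetaE => XYphi.
  rewrite (@char_evalD phi) (additiveN (char_evalD phi)).
  by apply/eqP; rewrite subr_eq0; exact/eqP.
apply: gauge_eq0.
  by have [phi <-] := char_eval_eq_gauge (X - Y); rewrite XY0.
have [phi <-] := char_eval_eq_gauge (- (X - Y)).
by rewrite (additiveN (@char_evalD phi)) XY0 oppr0.
Qed.

End Gauge.

(** * Density *)

(** A cluster point along an ultrafilter is a limit: a neighbourhood whose preimage is not in [G]
    would have the preimage of its complement in [G], and so miss the cluster point. *)
Lemma ultra_cvg_compact (S : Type) (T : topologicalType) (f : S -> T)
    (K : set T) (G : set_system S) : UltraFilter G -> compact K ->
  (forall s, K (f s)) -> exists l : T, f x @[x --> G] --> l.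
Proof.
move=> UG cK fK.
have [l [_ cl]] : K `&` cluster (f x @[x --> G]) !=set0.
  by apply: cK; exact: (@filterE _ G _ (f @^-1` K)).
exists l => A Al; have [//|GnA] := in_ultra_setVsetC (f @^-1` A) UG.
have [y [nAy Ay]] := cl (~` A) A GnA Al.
by [].
Qed.

(** * Compactness of the space of characters *)

Section Compactness.
Variables (R : realType) (F : perfectSemiFieldType) (E : F).
Hypothesis hE : standing R E.

Lemma SE_compact : compact [set: SE R E].
Proof.
rewrite compact_ultra => G UG _.
have /choice [l lG] X : exists l : R, char_eval X phi @[phi --> G] --> l.
  have [t Xt] := standing_bound hE X.
  apply: (@ultra_cvg_compact _ R (char_eval X) `[- ratr t, ratr t]%classic) => //.
    exact: segment_compact.
  by move=> phi; rewrite /= in_itv /= -ler_norml; exact: char_eval_bound.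
have uniq (f : SE R E -> R) (a b : R) :
    f phi @[phi --> G] --> a -> f phi @[phi --> G] --> b -> a = b.
  by move=> fa fb; exact: cvg_unique (@Rhausdorff R) _ _ _ _ fa fb.
have lE : l E = 1.
  apply: (uniq (char_eval E)) => //.
  by under eq_fun do rewrite char_eval_unit; exact: cvg_cst.
have lchar : is_character l.
  split=> [|X Y|X Y]; first by exists E; rewrite lE; exact/eqP/oner_neq0.
  - apply: (uniq (char_eval (X ⊕ Y))) => //.
    (* Writing [max] with an absolute value reduces its limit to those of sums and norms. *)
    under eq_fun do rewrite char_eval_oplus maxr_absE; rewrite maxr_absE.
    apply: cvgMr_tmp; apply: cvgD; first exact: cvgD.
    by apply: cvg_norm; exact: cvgB.
  - apply: (uniq (char_eval (X + Y))) => //.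
    under eq_fun do rewrite char_evalD.
    exact: cvgD.
exists (exist _ l (mem_set (conj lchar lE))); split=> //.
(* Convergence in the coarsest topology is checked on one evaluation at a time. *)
apply/cvg_sup => X A; rewrite nbhsE => -[B [[C oC <-] Cl] BA].
apply: filterS BA _; apply: (lG X).
exact: open_nbhs_nbhs.
Qed.

End Compactness.

(** A directed open cover of a compact space has a member that is the whole space. The sets [up i]
    generate a filter on indices, to which the near-covering form of compactness applies. *)
Lemma compact_directed (T : topologicalType) (I : Type) (S : set I)
    (Q : I -> set T) : compact [set: T] -> S !=set0 ->
  (forall i j, S i -> S j -> exists2 k, S k & Q i `|` Q j `<=` Q k) ->
  (forall i, S i -> open (Q i)) -> (forall t, exists2 i, S i & Q i t) ->
  exists2 i, S i & forall t, Q i t.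
Proof.
move=> /compact_near_coveringP cT S0 Sdir Qo Qt.
pose up i := [set k | S k /\ Q i `<=` Q k].
have Fup : Filter (filter_from S up).
  apply: filter_from_filter => // i j Si Sj.
  have [k Sk ijk] := Sdir i j Si Sj; exists k => // m [Sm km].
  by split; split=> // t Qit; apply/km/ijk; [left|right].
have [|i Si Qi] := cT I (filter_from S up) Q Fup.
  move=> t _; have [i Si Qit] := Qt t.
  exists (Q i, up i) => /=; last by move=> [u k] /= [Qiu [_]]; exact.
  split; last by exists i.
  by apply: open_nbhs_nbhs; split=> //; exact: Qo.
by exists i => // t; apply: (Qi i); split.
Qed.

(** * Lattice approximation of continuous functions *)

Section Density.
Variables (R : realType) (F : perfectSemiFieldType) (E : F).
Hypothesis hE : standing R E.

Lemma rat_approx (x e : R) : 0 < e -> exists t : rat, `|ratr t - x| < e.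
Proof.
move=> e0; have [|t] := @rat_in_itvoo R (x - e) (x + e); first by lra.
rewrite in_itv /= => /andP [? ?]; exists t; rewrite ltr_distl.
by apply/andP; split.
Qed.

Lemma interpolation (phi psi : SE R E) (a b e : R) : 0 < e ->
  (phi = psi -> a = b) ->
  exists X, `|char_eval X phi - a| < e /\ `|char_eval X psi - b| < e.
Proof.
move=> e0 ab.
(* The values are first interpolated exactly with real coefficients, which are then approximated by
   rationals. *)
have [X [s [t [sphi spsi]]]] : exists X (s t : R),
    s * char_eval X phi + t = a /\ s * char_eval X psi + t = b.
  have [pp|/eqP pp] := eqVneq phi psi.
    by exists 0, 0, a; rewrite !mul0r !add0r ab.
  have [X pX] : exists X, char_eval X phi != char_eval X psi.
    apply: contrapT => H; apply: pp; apply: val_inj; apply/funext => X.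
    by apply/eqP; apply: contrapT => /negP pX; apply: H; exists X.
  exists X, ((a - b) / (char_eval X phi - char_eval X psi)).
  exists (a - (a - b) / (char_eval X phi - char_eval X psi) * char_eval X phi).
  by split; field; rewrite subr_eq0.
have e2 : 0 < e / 2 by rewrite divr_gt0.
(* [M] bounds [X] at both characters; the added [1] makes it a legitimate divisor. *)
pose M : R := `|char_eval X phi| + `|char_eval X psi| + 1.
have M0 : 0 < M by rewrite ltr_wpDl // addr_ge0.
have [s' ss'] := @rat_approx s (e / 2 / M) (divr_gt0 e2 M0).
have [t' tt'] := @rat_approx t (e / 2) e2.
exists (qscale s' X + qscale t' E).
have close (chi : SE R E) c : s * char_eval X chi + t = c ->
    `|char_eval X chi| <= M ->
    `|char_eval (qscale s' X + qscale t' E) chi - c| < e.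
  move=> <- chiM; rewrite char_evalD !(additive_qscale (char_evalD chi)).
  rewrite char_eval_unit mulr1 opprD addrACA -mulrBl.
  apply: le_lt_trans (ler_normD _ _) _.
  rewrite [e]splitr ltr_leD //; last exact: ltW.
  rewrite normrM; apply: (@le_lt_trans _ _ (`|ratr s' - s| * M)).
    by rewrite ler_wpM2l.
  by rewrite -ltr_pdivlMr.
split; apply: close => //; rewrite /M.
  by rewrite -addrA lerDl addr_ge0.
by rewrite addrAC lerDr addr_ge0.
Qed.

Let open_lt_ceval (X : F) (f : C0 R (SE R E)) (e : R) :
  open [set phi | char_eval X phi < f phi + e].
Proof.
have -> : [set phi | char_eval X phi < f phi + e] =
    (fun phi => char_eval X phi - f phi) @^-1` [set x | x < e].
  by apply/seteqP; split=> phi /=; rewrite ltrBlDl.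
apply: (open_comp _ (@open_lt _ e)) => phi _; apply: continuousB.
  exact: char_eval_continuous.
exact: cts_fun.
Qed.

Let open_gt_ceval (X : F) (f : C0 R (SE R E)) (e : R) :
  open [set phi | f phi - e < char_eval X phi].
Proof.
have -> : [set phi | f phi - e < char_eval X phi] =
    (fun phi => f phi - char_eval X phi) @^-1` [set x | x < e].
  by apply/seteqP; split=> phi /=; rewrite ltrBlDl ltrBlDr addrC.
apply: (open_comp _ (@open_lt _ e)) => phi _; apply: continuousB.
  exact: cts_fun.
exact: char_eval_continuous.
Qed.

(** Negation reverses the order, so this is the greatest lower bound. *)
Let meet (X Y : F) : F := - (- X ⊕ - Y).

Let char_eval_meet (phi : SE R E) X Y :
  char_eval (meet X Y) phi = Num.min (char_eval X phi) (char_eval Y phi).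
Proof.
rewrite /meet (additiveN (char_evalD phi)) char_eval_oplus.
by rewrite !(additiveN (char_evalD phi)) oppr_max !opprK.
Qed.

(** Interpolants of [f] at [phi] and [psi] stay below [f + e] near [psi]. Meets enlarge the region
    where this holds and keep the lower bound at [phi], so compactness gives a single element. *)
Lemma approx_below (f : C0 R (SE R E)) (e : R) (phi : SE R E) : 0 < e ->
  exists X, f phi - e < char_eval X phi /\
    forall psi, char_eval X psi < f psi + e.
Proof.
move=> e0.
have ex psi : exists2 X, f phi - e < char_eval X phi &
    char_eval X psi < f psi + e.
  have [|X []] := @interpolation phi psi (f phi) (f psi) e e0; first by move=> ->.
  by rewrite !ltr_distl => /andP [? _] /andP [_ ?]; exists X.
have [||||X] := @compact_directed _ _ [set X | f phi - e < char_eval X phi]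
  (fun X psi => char_eval X psi < f psi + e) (SE_compact hE).
- by have [X ?] := ex phi; exists X.
- move=> X Y Xf Yf; exists (meet X Y).
    by rewrite /= char_eval_meet lt_min Xf.
  by move=> psi /=; rewrite char_eval_meet gt_min => -[->|->]; rewrite ?orbT.
- by move=> X _; exact: open_lt_ceval.
- by move=> psi; have [X] := ex psi; exists X.
by move=> ? ?; exists X.
Qed.

(** Joins keep the bound [f + e] everywhere and enlarge the region above [f - e]; the elements given
    by [approx_below] make these regions a cover. *)
Lemma approx_uniform (f : C0 R (SE R E)) (e : R) : 0 < e ->
  exists X, forall phi, `|f phi - char_eval X phi| < e.
Proof.
move=> e0; pose S := [set X | forall psi : SE R E, char_eval X psi < f psi + e].
(* Any character yields a member of [S], so for empty [S] the claim is vacuous and [0] is an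
   arbitrary witness. *)
have [S0|S0] := pselect (S !=set0); last first.
  exists 0 => phi; have [X [_ SX]] := approx_below f phi e0.
  by case: S0; exists X.
have [|||X SX Xf] := @compact_directed _ _ S
  (fun X phi => f phi - e < char_eval X phi) (SE_compact hE) S0.
- move=> X Y SX SY; exists (X ⊕ Y).
    by move=> phi; rewrite char_eval_oplus gt_max SX SY.
  by move=> psi /=; rewrite char_eval_oplus lt_max => -[->|->]; rewrite ?orbT.
- by move=> X _; exact: open_gt_ceval.
- by move=> phi; have [X [? ?]] := approx_below f phi e0; exists X.
by exists X => phi; rewrite distrC ltr_distl Xf SX.
Qed.

Lemma Theta_dense : dense (range (Theta R E)).
Proof.
move=> O [f Of] oO.
have /C0_nbhsP [e e0 eO] : nbhs f O by exact: open_nbhs_nbhs.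
(* Halving keeps the supremum strictly below [e]. *)
have e2 : 0 < e / 2 by rewrite divr_gt0.
have [X Xf] := @approx_uniform f (e / 2) e2.
exists (Theta R E X); split; last by exists X.
apply: eO => /=; apply: (@le_lt_trans _ _ (e / 2)%:E).
  by apply: ge_ereal_sup => _ [phi _ <-]; rewrite lee_fin ltW.
by rewrite lte_fin ltr_pdivrMr // ltr_pMr // ltr1n.
Qed.

Variables (N : F -> R) (hN : is_fnorm E N).

(** The map is 1-Lipschitz: characters are bounded by [sradius], which is bounded by [N]. *)
Lemma Theta_continuous :
  continuous (Theta R E : fnorm_space hE hN -> C0 R (SE R E)).
Proof.
move=> X A /nbhs_ballP [e e0 eA].
apply/nbhs_ballP; exists e => // Y XY; apply/eA/C0_ballE => phi.
rewrite !ThetaE -(additiveN (char_evalD phi)) -(char_evalD phi).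
apply: le_lt_trans (char_eval_sradius hE phi _) _.
exact: le_lt_trans (fnorm_sradius hN _) XY.
Qed.

End Density.

Unset Implicit Arguments.

Theorem proposition4 (R : realType) (F : perfectSemiFieldType) (E : F)
    (hE : standing R E) (N : F -> R) (hN : is_fnorm E N)
    (Ncomplete : complete_space (fnorm_space hE hN)) :
  [/\ semifield_hom (Theta R E : F -> C0 R (SE R E)),
      injective (Theta R E : F -> C0 R (SE R E)),
      continuous (Theta R E : fnorm_space hE hN -> C0 R (SE R E)) &
      dense (range (Theta R E : F -> C0 R (SE R E)))].
Proof.
split.
- by split=> X Y; apply/continuousEP => phi;
    [exact: char_eval_oplus|exact: char_evalD].
- exact: Theta_injective hE.
- exact: Theta_continuous.
- exact: Theta_dense hE.
Qed.
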